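(* There exist a finitely generated residually finite group $G$ and a descending chain $(G_i)_{i\in\mathbb{N}}$ of finite index normal subgroups of $G$, with $\bigcap_{i\in\mathbb{N}} G_i=\{1\}$, such that the limit $\lim_{i\to\infty}\frac{b_1(G_i)}{[G:G_i]}$ does not exist.
   Context: For a finitely generated group $H$, $b_1(H)=\dim_{\mathbb{Q}} H_1(H;\mathbb{Q})$ is the first Betti number of $H$ with (trivial) rational coefficients. A descending chain means $G_1\supseteq G_2\supseteq\cdots$ (each term a normal subgroup of $G$). *)

(* Defs.v *)
From HB Require Import structures.
From mathcomp Require Export all_boot all_order all_algebra.
From mathcomp Require Export finmap freeg.
From mathcomp Require Export all_classical all_reals all_analysis.

Set Implicit Arguments.
Unset Strict Implicit.
Unset Printing Implicit Defensive.

Import GRing.Theory.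

Local Open Scope classical_set_scope.
Local Open Scope ring_scope.

(* [groupType] allows infinite groups. A term of [groupClosed G] is a boolean *)
(* predicate on G bundled with a proof that it is a subgroup; since we work   *)
(* classically, every subgroup of G is of this form.                          *)
Section Subgroups.
Context {G : groupType}.
Implicit Types N : groupClosed G.

Definition normal_subgroup N : Prop :=
  forall g x : G, x \in N -> (x ^ g)%g \in N.

Definition left_cosets N : set (set G) :=
  range (fun g : G => [set (g * x)%g | x in [set` N]]).

Definition finite_index N : Prop := finite_set (left_cosets N).

(* [G : N], with value 0 when the index is infinite. *)
Definition subgroup_index N : nat := #|` fset_set (left_cosets N)|%fset.

Record subgroup N : Type :=
  Subgroup { subgroup_val :> G; _ : subgroup_val \in N }.

End Subgroups.

HB.instance Definition _ (G : groupType) (N : groupClosed G) :=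
  [isSub for @subgroup_val G N].
HB.instance Definition _ (G : groupType) (N : groupClosed G) :=
  [Choice of subgroup N by <:].

Fact subgroup_group_closed (G : groupType) (N : groupClosed G) :
  group_closed (fun x : G => x \in N).
Proof. by split=> [|x y xN yN]; [exact: gpred1 | exact: gpredF]. Qed.

HB.instance Definition _ (G : groupType) (N : groupClosed G) :=
  SubChoice_isSubGroup.Build G (fun x => x \in N) (subgroup N)
    (subgroup_group_closed N).

Definition finitely_generated (G : groupType) : Prop :=
  exists S : seq G, forall N : groupClosed G,
    {subset S <= N} -> forall x : G, x \in N.

Definition residually_finite (G : groupType) : Prop :=
  forall g : G, g <> 1%g ->
    exists N : groupClosed G,
      [/\ normal_subgroup N, finite_index N & g \notin N].

Section HomologyDimension.
Context {F : fieldType} {U V W : lmodType F}.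
Implicit Types (f : U -> V) (g : V -> W).

(* The e_i are cycles whose classes form a basis of ker g / im f. *)
Definition homology_basis f g n (e : 'I_n -> V) : Prop :=
  [/\ forall i, g (e i) = 0,
      forall a : 'I_n -> F,
        range f (\sum_(i < n) a i *: e i) -> forall i, a i = 0
    & forall z : V, g z = 0 ->
        exists a : 'I_n -> F, range f (z - \sum_(i < n) a i *: e i)].

(* dim_F (ker g / im f), with value 0 when that dimension is infinite. *)
Definition homology_dim f g : nat :=
  xget 0%N [set n | exists e : 'I_n -> V, homology_basis f g e].

End HomologyDimension.

(* The inhomogeneous bar complex of H with trivial coefficients Q, in degrees *)
(* 2, 1 and 0: the module of n-chains is the Q-vector space with basis H^n,   *)
(*   d2 [g|h] = g.[h] - [gh] + [g],   d1 [g] = g.[] - [],                     *)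
(* where g acts as the identity on Q.                                         *)
Definition bar_d2 (H : groupType) : {freeg (H * H)%type / rat} -> {freeg H / rat} :=
  fglift (fun gh => << gh.2 >> - << (gh.1 * gh.2)%g >> + << gh.1 >>).

Definition bar_d1 (H : groupType) : {freeg H / rat} -> rat^o :=
  fglift (fun _ : H => (1 - 1 : rat^o)).

Definition first_betti (H : groupType) : nat :=
  homology_dim (@bar_d2 H) (@bar_d1 H).

(* Main.v *)
From HB Require Import structures.
From mathcomp Require Import all_fingroup cyclic generic_quotient.
From mathcomp Require Import ring lra zify.
Require Import Defs.

(** Why the theorem is true.

Let F be the free product of three groups of order two.  The group G is F / K,
where K is the intersection of a chain N_0 > N'_0 > N_1 > N'_1 > ... of finite
index normal subgroups of F with quotients Q_0, Q'_0, Q_1, Q'_1, ..., and the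
chain in G is the image of this one.  The quotients are built so that b_1 of
the image of N_k is at least |Q_k| / 4, while b_1 of the image of N'_k is at
most |Q'_k| / 8.

Homomorphisms to the rationals (written QQ) are seen as path sums.  An edge
function om : Q -> letter -> QQ on the Cayley graph of Q = F / N gives a
homomorphism on the loops of the graph, that is on N, by summation along the
path labelled by a word ([psum]); coboundaries give zero.  Along with Q_k goes
a finite list R_k of relators x^m, m being the order of x in Q_k, which will be
trivial in G.  The sum of om along x^m from v does not change when v moves to
v x, so a relator costs only |Q_k| / m linear conditions on om.  Since the
numbers 1 / m have sum less than 7 / 4 (the squares of the letters already give
3 / 2), the edge functions that vanish on R_k have dimension at least
(3 - 7 / 4) |Q_k|, and modulo coboundaries at least |Q_k| / 4
([independent_edge_functions]).

One step of the construction ([exists_next_stage]).  Let N'_k consist of the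
loops of Q_k along which every Z/M-valued edge function that vanishes on R_k
has sum zero ([extension]); its index tends to infinity with M, and
N_k / N'_k is abelian of exponent dividing M.  Now add relators x^m, where x
runs over the commutators of the Schreier generators of N_k.  A second
extension Q_{k+1} makes the order m of x as large as desired, hence the cost of
its relator as small as desired, except for those x which are killed by all the
edge functions on Q'_k that vanish on R_k, and these need no relator.  Then a
homomorphism from the image of N'_k in G to QQ kills all commutators of N_k, so
it is determined by its values at the M-th powers of the 3 |Q_k| Schreier
generators of N_k ([hom_vanish], [odd_first_betti]).

The large Betti number of N_k survives in G.  All relators added later are
powers of commutators of elements of N_k, so an edge function on Q_k that
vanishes on R_k still vanishes on them when it is pulled back to Q_n for
n >= k.  Its sum along a word of K is therefore divisible by moduli that tend
to infinity, hence is zero ([tower_survival], [even_first_betti]). *)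
Set Implicit Arguments.
Unset Strict Implicit.
Unset Printing Implicit Defensive.

Import Order.TTheory GRing.Theory Num.Theory numFieldNormedType.Exports.
Local Open Scope classical_set_scope.
Local Open Scope ring_scope.

(** * Computing the first Betti number from homomorphisms to the rationals *)

Section FreegLinear.
Context {F : fieldType} {K : choiceType} {M : lmodType F} (f : K -> M).

Fact fglift_semilinear : semilinear (fglift f : {freeg K / F} -> M).
Proof.
have D : {morph (fglift f : {freeg K / F} -> M) : x y / x + y}.
  pose fB := lift_is_additive f.
  have f0 : fglift f 0 = 0 by rewrite -(subrr (0 : {freeg K / F})) fB subrr.
  have fN y : fglift f (- y) = - fglift f y by rewrite -(sub0r y) fB f0 sub0r.
  by move=> x y; rewrite -[X in x + X]opprK fB fN opprK.
split=> // c z.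
have f0 : fglift f 0 = 0 by apply: (addrI (fglift f 0)); rewrite -D !addr0.
have S (s : seq K) (G : K -> {freeg K / F}) :
    fglift f (\sum_(x <- s) G x) = \sum_(x <- s) fglift f (G x).
  exact: (big_morph _ D f0).
have -> : c *: z = \sum_(x <- dom z) << c * coeff x z *g x >> by [].
rewrite -[in RHS](freeg_sumE z) !S scaler_sumr.
by apply: eq_bigr => x _; rewrite !liftU scalerA.
Qed.

HB.instance Definition _ :=
  GRing.isSemilinear.Build F {freeg K / F} M _ (fglift f) fglift_semilinear.

Lemma fglift1 x : fglift f << x >> = f x.
Proof. by rewrite liftU scale1r. Qed.

End FreegLinear.

(** A subspace of maximal dimension among those contained in P is all of P, for
    otherwise one more vector could be adjoined. *)
Lemma vspace_of_pred (K : fieldType) (vT : vectType K) (P : vT -> Prop) :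
  P 0 -> (forall a u v, P u -> P v -> P (a *: u + v)) ->
  exists U : {vspace vT}, forall v, v \in U <-> P v.
Proof.
move=> P0 PL.
pose Q n := `[< exists U : {vspace vT},
  \dim U = n /\ forall v, v \in U -> P v >].
have exQ : exists n, Q n.
  exists 0%N; apply/asboolP; exists 0%VS; rewrite dimv0; split=> // v.
  by rewrite memv0 => /eqP ->.
have bQ n : Q n -> (n <= \dim {: vT})%N.
  by move=> /asboolP [U [<- _]]; rewrite dimvS ?subvf.
case: (ex_maxnP exQ bQ) => n /asboolP [U [dU UP]] nmax.
exists U => v; split; first exact: UP.
move=> Pv; apply: contrapT => /negP vU.
have /nmax : Q (\dim (U + <[v]>)).
  apply/asboolP; exists (U + <[v]>)%VS; split=> //.
  move=> _ /memv_addP [u uU [_ /vlineP [a ->] ->]].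
  by rewrite addrC; apply: PL => //; exact: UP.
rewrite -dU leqNgt => /negP; apply.
rewrite (ltn_leqif (dimv_leqif_sup (addvSl _ _))).
by apply: contra vU => /subvP; apply; apply: (subvP (addvSr _ _)); rewrite memv_line.
Qed.

Lemma wide_left_kernel (F : fieldType) (m n : nat) (A : 'M[F]_(m, n)) :
  (n < m)%N -> exists2 c : 'I_m -> F, exists i, c i != 0 &
    forall j, \sum_i c i * A i j = 0.
Proof.
move=> nm; have : kermx A != 0.
  rewrite -mxrank_eq0 mxrank_ker subn_eq0 -ltnNge.
  exact: leq_ltn_trans (rank_leq_col A) nm.
case/rowV0Pn => c /sub_kermxP cA /rV0Pn ci; exists (c 0) => // j.
by move/matrixP: cA => /(_ 0 j); rewrite !mxE.
Qed.

Section FirstBetti.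
Context (H : groupType).
Implicit Types (z : {freeg H / rat}).

(** These maps form the dual of the first homology of H. *)
Definition is_hom (phi : H -> rat^o) := forall x y, phi (x * y)%g = phi x + phi y.

Lemma is_hom_sum (n : nat) (c : 'I_n -> rat) (phi : 'I_n -> H -> rat^o) :
  (forall i, is_hom (phi i)) -> is_hom (fun h => \sum_i c i * phi i h).
Proof.
by move=> hphi x y; rewrite -big_split; apply: eq_bigr => i _; rewrite hphi mulrDr.
Qed.

Definition boundary z := range (@bar_d2 H) z.

Lemma boundary0 : boundary 0.
Proof. by exists 0 => //; rewrite /bar_d2 raddf0. Qed.

Lemma boundaryD z1 z2 : boundary z1 -> boundary z2 -> boundary (z1 + z2).
Proof. by move=> [t1 _ <-] [t2 _ <-]; exists (t1 + t2) => //; rewrite /bar_d2 raddfD. Qed.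

Lemma boundaryZ c z : boundary z -> boundary (c *: z).
Proof. by move=> [t _ <-]; exists (c *: t) => //; rewrite /bar_d2 linearZ. Qed.

Definition homologous z1 z2 := boundary (z1 - z2).

Lemma homologous_refl z : homologous z z.
Proof. by rewrite /homologous subrr; exact: boundary0. Qed.

Lemma homologous_sym z1 z2 : homologous z1 z2 -> homologous z2 z1.
Proof.
rewrite /homologous -opprB -scaleN1r => /(boundaryZ (- 1)).
by rewrite scalerA mulN1r opprK scale1r.
Qed.

Lemma homologous_trans z2 z1 z3 :
  homologous z1 z2 -> homologous z2 z3 -> homologous z1 z3.
Proof. by move=> h12 /(boundaryD h12); rewrite addrA subrK. Qed.

Lemma homologousD z1 z2 t1 t2 :
  homologous z1 z2 -> homologous t1 t2 -> homologous (z1 + t1) (z2 + t2).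
Proof. by move=> hz /(boundaryD hz); rewrite addrACA -opprD. Qed.

Lemma homologousZ c z1 z2 : homologous z1 z2 -> homologous (c *: z1) (c *: z2).
Proof. by move=> /(boundaryZ c); rewrite scalerBr. Qed.

Lemma homologous_sum (I : Type) (s : seq I) (G1 G2 : I -> {freeg H / rat}) :
  (forall i, homologous (G1 i) (G2 i)) ->
  homologous (\sum_(i <- s) G1 i) (\sum_(i <- s) G2 i).
Proof.
move=> hG; elim: s => [|i s IH]; first by rewrite !big_nil; exact: homologous_refl.
by rewrite !big_cons; exact: homologousD.
Qed.

Lemma homologousM g h : homologous << (g * h)%g >> (<< g >> + << h >>).
Proof.
exists (- << (g, h) >>) => //; rewrite /bar_d2 raddfN /= fglift1 /=.
by rewrite addrAC opprB addrC.
Qed.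

Lemma bar_d1_eq0 z : bar_d1 z = 0.
Proof.
rewrite /bar_d1 -(freeg_sumE z) raddf_sum big1 //= => x _.
by rewrite liftU subrr scaler0.
Qed.

Lemma hom_boundary (phi : H -> rat^o) z : is_hom phi -> boundary z -> fglift phi z = 0.
Proof.
move=> hphi [t _ <-]; rewrite /bar_d2 -(freeg_sumE t) !raddf_sum big1 //= => -[g h] _.
rewrite liftU linearZ /= raddfD raddfB /= !fglift1 /= hphi opprD addrCA addrC.
by rewrite -!addrA addNr addr0 subrr scaler0.
Qed.

Lemma fglift_comb (n : nat) (c : 'I_n -> rat) (phi : 'I_n -> H -> rat^o) z :
  fglift (fun h => \sum_i c i * phi i h : rat^o) z = \sum_i c i * fglift (phi i) z.
Proof.
rewrite -(freeg_sumE z) raddf_sum /=.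
under [RHS]eq_bigr do rewrite raddf_sum mulr_sumr.
rewrite exchange_big; apply: eq_bigr => x _; rewrite /= !liftU scaler_sumr.
by apply: eq_bigr => i _; rewrite !liftU /GRing.scale /= mulrCA.
Qed.

Lemma freeg_lincomb z : z = \sum_(x <- dom z) coeff x z *: << x >>.
Proof.
rewrite -[LHS]freeg_sumE; apply: eq_bigr => x _; apply/eqP/freeg_eqP => y.
by rewrite coeffZ !coeffU mul1r.
Qed.

Lemma fgliftE (M : lmodType rat) (f : H -> M) z :
  fglift f z = \sum_(x <- dom z) coeff x z *: f x.
Proof.
rewrite {1}(freeg_lincomb z) raddf_sum; apply: eq_bigr => x _.
by rewrite /= linearZ /= fglift1.
Qed.

(** The coordinates of the class of [h] in a basis of the first homology are
    homomorphisms in [h].  If there were more of them than points [y i], some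
    nontrivial combination would vanish at all these points, hence everywhere. *)
Lemma first_betti_le (I : finType) (y : I -> H) :
  (forall phi, is_hom phi -> (forall i, phi (y i) = 0) -> forall h, phi h = 0) ->
  (first_betti H <= #|I|)%N.
Proof.
move=> yP; rewrite /first_betti /homology_dim.
case: xgetP => [n _ [e [_ e_free e_span]]|//].
rewrite leqNgt; apply/negP => In.
have e_inj (a b : 'I_n -> rat) :
    homologous (\sum_i a i *: e i) (\sum_i b i *: e i) -> forall i, a i = b i.
  move=> hab i; apply/eqP; rewrite -subr_eq0; apply/eqP.
  apply: (e_free (fun i => a i - b i)).
  by under eq_bigr do rewrite scalerBl; rewrite sumrB.
have /choice [a aP] (h : H) : exists a : 'I_n -> rat, homologous << h >> (\sum_i a i *: e i).
  exact/e_span/bar_d1_eq0.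
pose ai i h : rat^o := a h i.
have ai_hom i : is_hom (ai i).
  move=> g h; rewrite /ai; move: i; apply: (e_inj _ (fun i => a g i + a h i)).
  under [X in homologous _ X]eq_bigr do rewrite scalerDl.
  rewrite big_split; apply: homologous_trans (homologous_sym (aP _)) _.
  exact: homologous_trans (homologousM g h) (homologousD (aP g) (aP h)).
have ai_repr z : homologous z (\sum_i fglift (ai i) z *: e i).
  rewrite {1}(freeg_lincomb z).
  under [X in homologous _ X]eq_bigr do rewrite fgliftE scaler_suml.
  rewrite exchange_big; apply: homologous_sum => x /=.
  under [X in homologous _ X]eq_bigr do rewrite -scalerA.
  by rewrite -scaler_sumr; exact/homologousZ/aP.
have [c [j cj] cP] :=
  wide_left_kernel (\matrix_(i, k) ai i (y (enum_val k)) : 'M[rat]_(n, #|I|)) In.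
pose phi := fun h => \sum_i c i * ai i h : rat^o.
have phi0 : forall h, phi h = 0.
  apply: yP => [|i]; first exact: is_hom_sum.
  rewrite -[RHS](cP (enum_rank i)); apply: eq_bigr => k _.
  by rewrite mxE enum_rankK.
have /eqP := cj; apply.
have <- : fglift phi (e j) = c j.
  have aij i : fglift (ai i) (e j) = (i == j)%:R.
    symmetry; move: i; apply: e_inj.
    apply: homologous_trans (ai_repr (e j)).
    rewrite (bigD1 j) //= eqxx scale1r big1 ?addr0; first exact: homologous_refl.
    by move=> i /negbTE ->; rewrite scale0r.
  rewrite fglift_comb (bigD1 j) //= aij eqxx mulr1 big1 ?addr0 // => i /negbTE ij.
  by rewrite aij ij mulr0.
by rewrite fgliftE big1 // => x _; rewrite phi0 scaler0.
Qed.

(** The generators make the first homology finite dimensional, so that it has a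
    basis and [first_betti] is not the default value 0.  Pairing more independent
    homomorphisms than basis elements with that basis would leave a nonzero
    combination that vanishes on the basis. *)
Lemma first_betti_ge (J : finType) (y : J -> H) (k : nat) (phi : 'I_k -> H -> rat^o) :
  (forall h, exists s : seq J, h = (\prod_(j <- s) y j)%g) ->
  (forall i, is_hom (phi i)) ->
  (forall a : 'I_k -> rat, (forall h, \sum_i a i * phi i h = 0) -> forall i, a i = 0) ->
  (k <= first_betti H)%N.
Proof.
move=> gen hphi phi_free.
pose V := {ffun J -> rat^o}.
pose L (c : V) : {freeg H / rat} := \sum_j c j *: << y j >>.
have LD a u v : L (a *: u + v) = a *: L u + L v.
  rewrite /L scaler_sumr -big_split; apply: eq_bigr => j _.
  by rewrite !ffunE scalerDl scalerA.
have L0 : L 0 = 0.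
  by rewrite /L big1 // => j _; rewrite ffunE scale0r.
have [U UP] : exists U : {vspace V}, forall c, c \in U <-> boundary (L c).
  apply: vspace_of_pred; first by rewrite L0; exact: boundary0.
  by move=> a u v bu bv; rewrite LD; apply: boundaryD => //; exact: boundaryZ.
have L_span z : exists c, homologous z (L c).
  have L_span1 h : exists c, homologous << h >> (L c).
    have [s ->] := gen h; elim: s => [|j s [c cP]].
      exists 0; rewrite big_nil L0; have := homologousM 1 1; rewrite mul1g.
      move=> /homologous_sym; rewrite /homologous -addrA subrr addr0.
      by rewrite subr0.
    (* the indicator of j, to add the class of y j *)
    exists (1 *: [ffun i => (i == j)%:R] + c); rewrite big_cons.
    apply: homologous_trans (homologousM _ _) _; rewrite LD scale1r.
    apply: homologousD => //; rewrite /L (bigD1 j) //= ffunE eqxx scale1r.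
    rewrite big1 ?addr0; first exact: homologous_refl.
    by move=> i /negbTE ij; rewrite ffunE ij scale0r.
  rewrite (freeg_lincomb z); elim: (dom z) => [|x s [c cP]].
    by exists 0; rewrite big_nil L0; exact: homologous_refl.
  have [b bP] := L_span1 x; exists (coeff x z *: b + c).
  by rewrite big_cons LD; apply: homologousD => //; exact: homologousZ.
have Lsum n (b : 'I_n -> V) (a : 'I_n -> rat) :
    L (\sum_i a i *: b i) = \sum_i a i *: L (b i).
  apply: (big_ind2 (fun u v => L u = v)) => [|u1 v1 u2 v2 <- <-|i _] //.
    by rewrite -[u1]scale1r LD !scale1r.
  by rewrite -[_ *: _]addr0 LD L0 addr0.
have e_basis : homology_basis (@bar_d2 H) (@bar_d1 H)
    (fun i : 'I_(\dim U^C) => L (vbasis U^C)`_i).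
  split=> [i|a|z _]; first exact: bar_d1_eq0.
    rewrite -Lsum => /UP aU i.
    have : \sum_i a i *: (vbasis U^C)`_i \in (U :&: U^C)%VS.
      rewrite memv_cap aU; apply: memv_suml => j _; apply: memvZ.
      by apply: vbasis_mem; rewrite mem_nth // size_tuple.
    rewrite capv_compl memv0 => /eqP a0.
    by have /freeP := basis_free (vbasisP U^C); apply.
  have [c cP] := L_span z.
  have : c \in (U + U^C)%VS by rewrite addv_complf memvf.
  case/memv_addP => u uU [v vU cE].
  (* c = u + v with L u a boundary, so z is homologous to L v *)
  exists (fun i => coord (vbasis U^C) i v).
  rewrite -Lsum -coord_vbasis //; apply: homologous_trans cP _.
  rewrite cE -[u]scale1r LD scale1r /homologous addrK.
  exact/UP.
rewrite /first_betti /homology_dim.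
case: xgetP => [n _ [e [_ e_free e_span]]|]; last first.
  by move=> /(_ (\dim U^C)) []; exists (fun i => L (vbasis U^C)`_i).
rewrite leqNgt; apply/negP => nk.
have [c [j cj] cP] := wide_left_kernel (\matrix_(i, l) fglift (phi i) (e l)) nk.
have /eqP := cj; apply; move: j {cj}; apply: phi_free => h.
pose Phi := fun h => \sum_i c i * phi i h : rat^o.
have hPhi : is_hom Phi by exact: is_hom_sum.
have [a /(hom_boundary hPhi)] := e_span << h >> (bar_d1_eq0 _).
rewrite raddfB /= fglift1 => /eqP; rewrite subr_eq0 => /eqP.
rewrite /Phi => ->; rewrite raddf_sum big1 //= => l _.
rewrite linearZ /= fglift_comb.
by have := cP l; under eq_bigr do rewrite mxE; move=> ->; rewrite scaler0.
Qed.
End FirstBetti.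

(** * Words, marked finite groups and path sums *)

(** Each letter will act as an involution, so every group element is the value
    of a word without inverses, and reversing a word inverts its value. *)
Notation letter := 'I_3.
Notation word := (seq letter).

Definition wpow (x : word) (n : nat) : word := flatten (nseq n x).
Definition wcomm (a b : word) : word := rev a ++ rev b ++ a ++ b.

Section Evaluation.
Context {G : groupType} (gam : letter -> G).

Definition evalw (w : word) : G := (\prod_(s <- w) gam s)%g.

Lemma evalw_nil : evalw [::] = 1%g. Proof. exact: big_nil. Qed.

Lemma evalw_cons s w : evalw (s :: w) = (gam s * evalw w)%g.
Proof. exact: big_cons. Qed.

Lemma evalw_cat u w : evalw (u ++ w) = (evalw u * evalw w)%g.
Proof. exact: big_cat. Qed.

Lemma evalw1 s : evalw [:: s] = gam s.
Proof. exact: big_seq1. Qed.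

Lemma evalw_wpow x n : evalw (wpow x n) = (evalw x ^+ n)%g.
Proof.
elim: n => [|n IH]; first exact: evalw_nil.
by rewrite expgS -IH -evalw_cat.
Qed.

Hypothesis gam_inv : forall s, (gam s * gam s = 1)%g.

Lemma evalw_rev w : evalw (rev w) = (evalw w)^-1%g.
Proof.
elim: w => [|s w IH]; first by rewrite /rev /= evalw_nil invg1.
rewrite rev_cons -cats1 evalw_cat IH evalw1 evalw_cons invgM; congr (_ * _)%g.
by rewrite (mulg1_eq (gam_inv s)).
Qed.

Lemma evalw_wcomm a b : evalw (wcomm a b) = [~ evalw a, evalw b]%g.
Proof. by rewrite /wcomm !evalw_cat !evalw_rev. Qed.

End Evaluation.

(** A finite quotient of the free product of three groups of order two. *)
Record mgroup := MGroup {
  mgroup_sort :> finGroupType;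
  gen : letter -> mgroup_sort;
  gen_inv : forall s, (gen s * gen s = 1)%g;
  gen_surj : forall g, exists w, evalw gen w = g }.
Arguments gen {m}.

Notation ev Q := (evalw (@gen Q)).

Section PathSum.
Context {Q : mgroup} {V : zmodType}.
Implicit Types (om : Q -> letter -> V) (v : Q) (w : word).

Fixpoint psum om v w : V :=
  if w is s :: w' then om v s + psum om (v * gen s)%g w' else 0.

Lemma psum_cat om v u w : psum om v (u ++ w) = psum om v u + psum om (v * ev Q u)%g w.
Proof.
elim: u v => [|s u IH] v /=; first by rewrite evalw_nil mulg1 add0r.
by rewrite IH evalw_cons mulgA addrA.
Qed.

Lemma psum_translate om g v w :
  psum (fun u => om (g * u)%g) v w = psum om (g * v)%g w.
Proof. by elim: w v => //= s w IH v; rewrite IH mulgA. Qed.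

Lemma psum_loop om v x n : ev Q x = 1%g -> psum om v (wpow x n) = psum om v x *+ n.
Proof.
move=> x1; elim: n => // n IH.
by rewrite mulrS -IH [wpow _ _]/(x ++ wpow x n) psum_cat x1 mulg1.
Qed.

(** The entry (x, m) of a list of relators stands for the relator x^m. *)
Definition kills om (R : seq (word * nat)) :=
  forall r, r \in R -> forall v, psum om v (wpow r.1 r.2) = 0.

Lemma kills_translate om R g : kills om R -> kills (fun u => om (g * u)%g) R.
Proof. by move=> k r rR v; rewrite psum_translate; exact: k. Qed.

Definition has_involutions (R : seq (word * nat)) := forall s : letter, ([:: s], 2%N) \in R.

Context (om : Q -> letter -> V) (R : seq (word * nat)).
Hypotheses (invR : has_involutions R) (omR : kills om R).

(** The relators s^2 make an edge function antisymmetric: traversing an edge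
    backwards gives the opposite value. *)
Lemma psum_rev v w : psum om (v * ev Q w)%g (rev w) = - psum om v w.
Proof.
elim: w v => [|s w IH] v; first by rewrite /rev /= oppr0.
rewrite rev_cons -cats1 psum_cat evalw_cons mulgA IH (evalw_rev (@gen_inv Q)).
rewrite mulgK /= addr0 opprD addrC; congr (_ + _).
have := omR (invR s) v; rewrite /= addr0 => /eqP.
by rewrite addrC addr_eq0 => /eqP.
Qed.

Lemma psum_wcomm v a b : ev Q a = 1%g -> ev Q b = 1%g -> psum om v (wcomm a b) = 0.
Proof.
move=> a1 b1; have E := evalw_rev (@gen_inv Q).
have := psum_rev v a; have := psum_rev v b.
rewrite a1 b1 mulg1 /wcomm !psum_cat !E a1 b1 invg1 !mulg1 => -> ->.
by rewrite addrA -opprD addNr.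
Qed.

Lemma psum_endpoint v a b : ev Q a = ev Q b ->
  psum om v (a ++ rev b) = 0 -> psum om v a = psum om v b.
Proof. by move=> ab; rewrite psum_cat ab psum_rev => /eqP; rewrite subr_eq0 => /eqP. Qed.

End PathSum.

Lemma psum_morph (Q : mgroup) (V V' : zmodType) (f : {additive V -> V'})
    (om : Q -> letter -> V) v w :
  psum (fun u s => f (om u s)) v w = f (psum om v w).
Proof. by elim: w v => [|s w IH] v /=; rewrite ?raddf0 // IH raddfD. Qed.

(** Restricting to the subgroup generated by the letters keeps the kernel and
    makes the values of words exhaust the group. *)
Lemma mark_group (gT : finGroupType) (p : letter -> gT) :
  (forall s, p s * p s = 1)%g ->
  exists Q : mgroup, forall w, ev Q w = 1%g <-> evalw p w = 1%g.
Proof.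
move=> p_inv; pose Gam := <<[set:: codom p]>>%G.
have pG s : p s \in Gam by apply: mem_gen; rewrite inE codom_f.
pose q s : subg_of Gam := subg Gam (p s).
have qE w : sgval (evalw q w) = evalw p w.
  elim: w => [|s w IH]; first by rewrite !evalw_nil.
  by rewrite !evalw_cons -IH /= subgK.
have q_inv s : (q s * q s = 1)%g.
  by apply: val_inj; rewrite /= !subgK //= p_inv.
have q_surj g : exists w, evalw q w = g.
  have /gen_prodgP [n [c cP gE]] : sgval g \in Gam by exact: subgP.
  have /choice [l lP] : forall i, exists s, c i = p s.
    by move=> i; have := cP i; rewrite inE => /codomP.
  exists [seq l i | i <- index_enum 'I_n]; apply: val_inj; rewrite /= qE gE /evalw.
  by rewrite big_map; apply: eq_bigr => i _; rewrite lP.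
exists (MGroup q_inv q_surj) => w; rewrite -qE; split=> [-> //|w1].
exact: val_inj.
Qed.

Section Extension.
Context (Q : mgroup) (R : seq (word * nat)) (M : nat).
Hypothesis invR : has_involutions R.
Hypothesis R1 : forall r, r \in R -> ev Q (wpow r.1 r.2) = 1%g.

Let X := ({ffun Q * letter -> 'Z_M} * (Q * 'Z_M))%type.
Let killsb (om : {ffun Q * letter -> 'Z_M}) :=
  [forall v, all (fun r => psum (fun u s => om (u, s)) v (wpow r.1 r.2) == 0) R].
Let shift om (v : Q) w : 'Z_M := if killsb om then psum (fun u s => om (u, s)) v w else 0.
Let move_fun s (x : X) : X := (x.1, (x.2.1 * gen s, x.2.2 + shift x.1 x.2.1 [:: s])%g).

Lemma killsbP (om : {ffun Q * letter -> 'Z_M}) :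
  reflect (kills (fun u s => om (u, s)) R) (killsb om).
Proof.
apply: (iffP forallP) => [k r rR v|k v].
  by have /allP /(_ _ rR) /eqP := k v.
by apply/allP => r rR; apply/eqP/k.
Qed.

Lemma move_inj s : injective (move_fun s).
Proof.
move=> [om [v t]] [om' [v' t']] E; have := congr1 (fun x => x.1) E; rewrite /= => om_eq.
have := congr1 (fun x => x.2.1) E; rewrite /= => /mulIg v_eq.
by have := congr1 (fun x => x.2.2) E; rewrite /= om_eq v_eq => /addIr ->.
Qed.

Let mperm s : {perm X} := perm (@move_inj s).

Lemma evalw_mperm w om v t :
  evalw mperm w (om, (v, t)) = (om, (v * ev Q w, t + shift om v w)%g).
Proof.
elim: w v t => [|s w IH] v t.
  by rewrite !evalw_nil perm1 mulg1 /shift /= if_same addr0.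
rewrite evalw_cons permM permE /= IH evalw_cons mulgA -addrA; congr (_, (_, _ + _)).
by rewrite /shift; case: ifP; rewrite ?addr0 //= addr0.
Qed.

(** The letters act on triples (om, v, t), where om is a Z/M-valued edge
    function, by moving v along an edge and adding the value of om at this edge
    to t when om kills R.  A word acts trivially exactly when it is a loop along
    which all these functions have sum zero. *)
Lemma extension : exists Q' : mgroup, forall w, ev Q' w = 1%g <->
  ev Q w = 1%g /\ forall om : Q -> letter -> 'Z_M, kills om R -> forall v, psum om v w = 0.
Proof.
have mP w : evalw mperm w = 1%g <->
    ev Q w = 1%g /\ forall om : Q -> letter -> 'Z_M, kills om R -> forall v, psum om v w = 0.
  split=> [w1|[w1 wR]].
    have E om v : (v * ev Q w, 0 + shift om v w)%g = (v, 0).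
      have := evalw_mperm w om v 0; rewrite w1 perm1.
      by move=> /(congr1 snd) /= <-.
    split=> [|om omR v].
      by have /(congr1 fst) := E [ffun=> 0] 1%g; rewrite /= mul1g.
    have eqom : (fun u s => [ffun e => om e.1 e.2] (u, s)) = om.
      by apply/funext => u; apply/funext => s; rewrite ffunE.
    have /(congr1 snd) := E [ffun e => om e.1 e.2] v; rewrite /= add0r /shift eqom.
    by case: ifP => // /negP []; apply/killsbP; rewrite eqom.
  apply/perm.permP => -[om [v t]]; rewrite evalw_mperm perm1 w1 mulg1; congr (_, (_, _)).
  by rewrite /shift; case: ifP => [/killsbP/wR ->|_]; rewrite addr0.
have m_inv s : (mperm s * mperm s = 1)%g.
  rewrite -[LHS](_ : evalw mperm [:: s; s] = _); last by rewrite !evalw_cons evalw_nil mulg1.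
  by apply/mP; split=> [|om omR v]; [exact: R1 (invR s) | exact: omR (invR s) v].
by have [Q' Q'P] := mark_group m_inv; exists Q' => w; rewrite Q'P mP.
Qed.

End Extension.

Lemma intr_Zp_eq0 (M : nat) (z : int) : (1 < M)%N -> z%:~R = 0 :> 'Z_M -> (M %| z)%Z.
Proof.
move=> M1; case: z => n; rewrite ?NegzE ?mulrNz ?dvdzE ?abszN /=.
  move=> /(congr1 val); rewrite /= -pmulrn val_Zp_nat //= => /eqP; exact.
move=> /eqP; rewrite oppr_eq0 => /eqP /(congr1 val).
by rewrite /= -pmulrn val_Zp_nat //= => /eqP; exact.
Qed.

(** Integer valued edge functions are seen modulo M; powers and commutators of
    loops have sum zero modulo M because sums along loops are additive. *)
Lemma extension_spec (Q : mgroup) (R : seq (word * nat)) (M : nat) :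
  has_involutions R -> (1 < M)%N ->
  (forall r, r \in R -> ev Q (wpow r.1 r.2) = 1%g) ->
  exists Q' : mgroup,
  [/\ forall w, ev Q' w = 1%g -> ev Q w = 1%g,
      forall r, r \in R -> ev Q' (wpow r.1 r.2) = 1%g,
      forall w, ev Q' w = 1%g -> forall om : Q -> letter -> int, kills om R ->
        forall v, (M %| psum om v w)%Z
    & (forall w, ev Q w = 1%g -> ev Q' (wpow w M) = 1%g) /\
      (forall a b, ev Q a = 1%g -> ev Q b = 1%g -> ev Q' (wcomm a b) = 1%g)].
Proof.
move=> invR M1 R1; have [Q' Q'P] := extension M invR R1; exists Q'; split.
- by move=> w /Q'P [].
- by move=> r rR; apply/Q'P; split=> [|om omR v]; [exact: R1 | exact: omR].
- move=> w /Q'P [_ wP] om omR v; apply: intr_Zp_eq0 => //.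
  rewrite -(psum_morph (intmul (1 : 'Z_M))).
  by apply: wP => r rR u; rewrite psum_morph omR.
- split=> [w w1|a b a1 b1]; apply/Q'P; split=> [|om omR v].
  + by rewrite evalw_wpow w1 expg1n.
  + by rewrite psum_loop // -[_ *+ M]mulr_natr pchar_Zp // mulr0.
  + by rewrite (evalw_wcomm (@gen_inv Q)) a1 b1 commgg.
  + exact: psum_wcomm omR _ _ _ a1 b1.
Qed.

(** A loop with nonzero sum p needs at least M / |p| repetitions before its sum
    becomes divisible by M: this is how large orders, and large groups, arise. *)
Lemma extension_order (Q Q' : mgroup) (R : seq (word * nat)) (M : nat) :
  (forall w, ev Q' w = 1%g -> forall om : Q -> letter -> int, kills om R ->
        forall v, (M %| psum om v w)%Z) ->
  forall om : Q -> letter -> int, kills om R -> forall v x, ev Q x = 1%g ->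
  psum om v x != 0 -> (M <= #[ev Q' x]%g * `|psum om v x|)%N.
Proof.
move=> Q'P om omR v x x1 px.
have := Q'P (wpow x #[ev Q' x]%g) _ _ omR v.
rewrite evalw_wpow expg_order => /(_ erefl); rewrite psum_loop // dvdzE.
rewrite -mulr_natl natz abszM => /dvdn_leq; apply.
by rewrite muln_gt0 fingroup.order_gt0 absz_gt0.
Qed.

(** * Counting edge functions *)

Lemma exists_lfun (F : fieldType) (aT rT : vectType F) (f : aT -> rT) :
  (forall a u v, f (a *: u + v) = a *: f u + f v) ->
  exists g : 'Hom(aT, rT), forall v, g v = f v.
Proof.
move=> fL; pose h : {linear aT -> rT} := HB.pack f (GRing.isLinear.Build F aT rT _ f fL).
by exists (linfun h) => v; rewrite lfunE.
Qed.

Lemma dim_ffun_rat (T : finType) : \dim {: {ffun T -> rat^o}} = #|T|.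
Proof. by rewrite dimvf /dim /= muln1. Qed.

Section EdgeFunctions.
Context (Q : mgroup).
Notation edge_fun := {ffun Q * letter -> rat^o}.
(** Edge functions are stored as finite functions on pairs to have a vector
    space, and used in curried form by [psum]. *)
Definition uncurried (om : edge_fun) : Q -> letter -> rat^o := fun v s => om (v, s).

Lemma psum_comb a (om1 om2 : edge_fun) v w :
  psum (uncurried (a *: om1 + om2)) v w =
  a * psum (uncurried om1) v w + psum (uncurried om2) v w.
Proof.
elim: w v => [|s w IH] v /=; first by rewrite mulr0 addr0.
by rewrite IH /uncurried !ffunE mulrDr addrACA.
Qed.

Lemma psum0 v w : psum (uncurried 0) v w = 0.
Proof. by elim: w v => [|s w IH] v //=; rewrite IH /uncurried ffunE addr0. Qed.

Lemma psum_lincomb (k : nat) (a : 'I_k -> rat) (om : 'I_k -> edge_fun) v w :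
  psum (uncurried (\sum_i a i *: om i)) v w = \sum_i a i * psum (uncurried (om i)) v w.
Proof.
apply: (big_ind2 (fun u x => psum (uncurried u) v w = x)) => [|u1 x1 u2 x2 <- <-|i _].
- exact: psum0.
- by rewrite -[u1]scale1r psum_comb scale1r mul1r.
- by rewrite -[_ *: _]addr0 psum_comb psum0 addr0.
Qed.

(** Such functions are determined by their values on representatives of the
    left cosets of the cyclic group generated by x. *)
Lemma dim_periodic (x : Q) (U : {vspace {ffun Q -> rat^o}}) :
  (forall phi : {ffun Q -> rat^o}, phi \in U -> forall v, phi (v * x)%g = phi v) ->
  (\dim U <= #|Q| %/ #[x]%g)%N.
Proof.
move=> Ux; pose C := lcosets <[x]>%g [set: Q]%SET.
pose T : finType := {A : {set Q} | A \in C}.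
have cT : #|T| = (#|Q| %/ #[x]%g)%N.
  rewrite card_sig card_lcosets -divgS ?cardsT //.
  by apply/fintype.subsetP => y _; rewrite inE.
pose f (phi : {ffun Q -> rat^o}) : {ffun T -> rat^o} :=
  [ffun A : T => phi (fingroup.repr (val A))].
have [g gE] : exists g : 'Hom({ffun Q -> rat^o}, {ffun T -> rat^o}), forall v, g v = f v.
  by apply: exists_lfun => a u v; apply/ffunP => A; rewrite !ffunE.
rewrite -cT -(dim_ffun_rat T).
have <- : \dim (g @: U) = \dim U.
  apply: limg_dim_eq; apply/eqP; rewrite -subv0; apply/subvP => phi.
  rewrite memv_cap => /andP [phiU]; rewrite memv_ker gE memv0 => /eqP f0.
  apply/eqP/ffunP => v; rewrite ffunE.
  have vC : lcoset <[x]>%g v \in C by rewrite lcosetE; apply/lcosetsP; exists v; rewrite ?inE.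
  move/ffunP: f0 => /(_ (exist (fun A : {set Q} => A \in C) _ vC)); rewrite !ffunE /= => <-.
  have : fingroup.repr (lcoset <[x]> v)%g \in lcoset <[x]>%g v.
    by rewrite lcosetE; apply: (fingroup.mem_repr v); rewrite lcoset_refl.
  rewrite {2}lcosetE => /lcosetP [_ /cycleP [n ->] ->].
  elim: n => [|n IH]; first by rewrite mulg1.
  by rewrite expgSr mulgA Ux.
by apply: dimvS; exact: subvf.
Qed.

(** Imposing a relator x^m means intersecting with the kernel of a linear map to
    functions on Q.  Its image consists of functions that are periodic under
    right translation by x, because x^m closes up and may be read from any of
    the vertices v, v x, v x^2, ...; so it has dimension at most |Q| / m. *)
Lemma killing_space (R : seq (word * nat)) :
  (forall r, r \in R -> #[ev Q r.1]%g = r.2) ->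
  exists U : {vspace edge_fun}, (forall om, om \in U <-> kills (uncurried om) R) /\
    (3 * #|Q| <= \dim U + \sum_(r <- R) #|Q| %/ r.2)%N.
Proof.
elim: R => [|r R IH] ordR.
  exists fullv; split=> [om|]; first by rewrite memvf.
  by rewrite dim_ffun_rat card_prod card_ord big_nil addn0 mulnC.
have [|U [UP dU]] := IH; first by move=> q qR; apply: ordR; rewrite inE qR orbT.
pose f (om : edge_fun) : {ffun Q -> rat^o} := [ffun v => psum (uncurried om) v (wpow r.1 r.2)].
have [g gE] : exists g : 'Hom(edge_fun, {ffun Q -> rat^o}), forall v, g v = f v.
  by apply: exists_lfun => a u v; apply/ffunP => A; rewrite !ffunE psum_comb.
exists (U :&: lker g)%VS; split=> [om|].
  rewrite memv_cap memv_ker gE; split=> [/andP [/UP omR /eqP f0] q|omR].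
    rewrite inE => /orP [/eqP ->|]; last exact: omR.
    by move=> v; move/ffunP: f0 => /(_ v); rewrite !ffunE.
  apply/andP; split; first by apply/UP => q qR; apply: omR; rewrite inE qR orbT.
  by apply/eqP/ffunP => v; rewrite !ffunE omR // mem_head.
have r1 : #[ev Q r.1]%g = r.2 by apply: ordR; rewrite mem_head.
have dg : (\dim (g @: U) <= #|Q| %/ r.2)%N.
  rewrite -r1; apply: dim_periodic => _ /memv_imgP [om _ ->] v.
  rewrite gE !ffunE; apply: (addrI (psum (uncurried om) v r.1)).
  (* cut x^(m+1), read from v, after its first or before its last factor x *)
  have E : r.1 ++ wpow r.1 r.2 = wpow r.1 r.2 ++ r.1.
    elim: (r.2) => [|n IHn]; rewrite ?cats0 //=.
    by rewrite -[wpow _ _]/(r.1 ++ wpow r.1 n) {1}IHn catA.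
  rewrite -psum_cat E psum_cat addrC; congr (psum _ _ _ + _).
  by rewrite evalw_wpow -r1 expg_order mulg1.
rewrite big_cons addnCA; apply: leq_trans dU _.
rewrite -(limg_ker_dim g U) [X in (X + _ <= _)%N]addnC -addnA; exact: leq_add.
Qed.

(** An edge function with zero sum along all loops is the coboundary of its sum
    along any path from 1. *)
Lemma coboundary_space : exists B : {vspace edge_fun}, (\dim B <= #|Q|)%N /\
  forall om R, has_involutions R -> kills (uncurried om) R ->
    (forall w, ev Q w = 1%g -> psum (uncurried om) 1%g w = 0) -> om \in B.
Proof.
pose d (phi : {ffun Q -> rat^o}) : edge_fun := [ffun e => phi (e.1 * gen e.2)%g - phi e.1].
have [g gE] : exists g : 'Hom({ffun Q -> rat^o}, edge_fun), forall v, g v = d v.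
  apply: exists_lfun => a u v; apply/ffunP => e; rewrite !ffunE.
  by rewrite scalerBr opprD addrACA.
exists (limg g); split=> [|om R invR omR om0].
  rewrite -(dim_ffun_rat Q) -[X in (_ <= X)%N](limg_ker_dim g fullv).
  exact: leq_addl.
have /choice [t tP] := @gen_surj Q.
have -> : om = g [ffun v => psum (uncurried om) 1%g (t v)].
  rewrite gE; apply/ffunP => -[v s]; rewrite !ffunE /=.
  have E : psum (uncurried om) 1%g (t v ++ [:: s]) = psum (uncurried om) 1%g (t (v * gen s)%g).
    have tE : ev Q (t v ++ [:: s]) = ev Q (t (v * gen s)%g).
      by rewrite evalw_cat !tP evalw1.
    apply: (psum_endpoint invR omR tE); apply: om0.
    by rewrite evalw_cat (evalw_rev (@gen_inv Q)) tE mulgV.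
  by rewrite -E psum_cat mul1g tP /= addr0 addrC addKr.
by rewrite memv_img ?memvf.
Qed.

(** A complement of the coboundaries among the edge functions that kill R: its
    elements are still independent as homomorphisms on the kernel of F -> Q. *)
Lemma independent_edge_functions (R : seq (word * nat)) :
  has_involutions R -> (forall r, r \in R -> #[ev Q r.1]%g = r.2) ->
  exists (k : nat) (om : 'I_k -> edge_fun),
  [/\ (2 * #|Q| <= k + \sum_(r <- R) #|Q| %/ r.2)%N,
      forall i, kills (uncurried (om i)) R
    & forall a : 'I_k -> rat,
      (forall w, ev Q w = 1%g -> \sum_i a i * psum (uncurried (om i)) 1%g w = 0) ->
      forall i, a i = 0].
Proof.
move=> invR ordR; have [U [UP dU]] := killing_space ordR.
have [B [dB BP]] := coboundary_space.
pose W := (U :\: B)%VS; exists (\dim W), (fun i => (vbasis W)`_i); split=> [|i|a a0].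
- have := dimv_cap_compl U B; have : (\dim (U :&: B) <= \dim B)%N by apply/dimvS/capvSr.
  rewrite -/W; lia.
- apply/UP; apply: (subvP (diffvSl U B)); apply: vbasis_mem.
  by rewrite mem_nth // size_tuple.
- move=> i; set om := \sum_i a i *: (vbasis W)`_i.
  have omW : om \in W.
    apply: memv_suml => j _; apply: memvZ; apply: vbasis_mem.
    by rewrite mem_nth // size_tuple.
  have omR : kills (uncurried om) R by apply/UP/(subvP (diffvSl U B)).
  have omB : om \in B.
    by apply: (BP _ R) => // w w1; rewrite psum_lincomb a0.
  have /eqP om0 : om == 0 by rewrite -memv0 -(capv_diff U B) memv_cap omW.
  have /freeP := basis_free (vbasisP W); apply; exact: om0.
Qed.

Lemma clear_denominators (om : Q -> letter -> rat) :
  exists (D : int) (om' : Q -> letter -> int),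
    D != 0 /\ forall v s, (om' v s)%:~R = D%:~R * om v s.
Proof.
pose den (e : Q * letter) := denq (om e.1 e.2).
exists (\prod_e den e), (fun v s => numq (om v s) * \prod_(e | e != (v, s)) den e).
split=> [|v s]; first by apply/prodf_neq0 => e _; exact: denq_neq0.
rewrite [in RHS](bigD1 (v, s)) //= !intrM numqE.
by rewrite -[den (v, s)]/(denq (om v s)); ring.
Qed.

Lemma psum_int (R : seq (word * nat)) (om : Q -> letter -> rat) v w :
  kills om R -> psum om v w != 0 ->
  exists2 om' : Q -> letter -> int, kills om' R & psum om' v w != 0.
Proof.
move=> omR p0; have [D [om' [D0 E]]] := clear_denominators om.
have pE u x : (psum om' u x)%:~R = D%:~R * psum om u x :> rat.
  by elim: x u => [|s x IH] u /=; rewrite ?mulr0 // intrD IH E mulrDr.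
exists om' => [r rR u|].
  by apply/eqP; rewrite -(intr_eq0 rat) pE omR // mulr0.
by rewrite -(intr_eq0 rat) pE mulf_neq0 // intr_eq0.
Qed.

End EdgeFunctions.

(** * Homomorphisms that kill commutators *)

(** Let B be a normal subgroup of a group A with A / B abelian of exponent dividing
    M, and let phi be a homomorphism on B.  The elements whose
    A-conjugates are all killed by phi form a normal subgroup C; it contains all
    commutators of A as soon as it contains those of a generating family.  Then
    a |-> phi (a^M) is a homomorphism on A, determined by its values on the
    generating family, and it equals M * phi on B. *)
Section HomVanish.
Local Open Scope group_scope.
Context (G : groupType) (A B : G -> Prop) (I : Type) (y : I -> G) (M : nat).
Context (phi : G -> rat).
Hypotheses (A1 : A 1) (AM : forall a b, A a -> A b -> A (a * b)).
Hypotheses (B1 : B 1) (BM : forall a b, B a -> B b -> B (a * b)).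
Hypotheses (BJ : forall b a, B b -> A a -> B (b ^ a)) (BA : forall b, B b -> A b).
Hypotheses (Ay : forall i, A (y i)).
Hypothesis (gen_y : forall a, A a -> exists s : seq I, a = \prod_(i <- s) y i).
Hypotheses (comm_AB : forall a b, A a -> A b -> B [~ a, b]).
Hypotheses (pow_AB : forall a, A a -> B (a ^+ M)).
Hypothesis (phiM : forall a b, B a -> B b -> phi (a * b) = (phi a + phi b)%R).
Hypothesis (phi_comm : forall i j g, A g -> phi ([~ y i, y j] ^ g) = 0%R).
Hypothesis (phi_pow : forall i, phi (y i ^+ M) = 0%R).
Hypothesis M_gt0 : (0 < M)%N.

Let C c := B c /\ forall g, A g -> phi (c ^ g) = 0%R.

Let phi1 : phi 1 = 0%R.
Proof. by apply: (addrI (phi 1)); rewrite -phiM // mulg1 addr0. Qed.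

Let C1 : C 1.
Proof. by split=> // g _; rewrite conj1g. Qed.

Let CM a b : C a -> C b -> C (a * b).
Proof.
move=> [Ba a0] [Bb b0]; split=> [|g Ag]; first exact: BM.
by rewrite conjMg phiM ?a0 ?b0 ?addr0 //; apply: BJ.
Qed.

Let CJ c a : C c -> A a -> C (c ^ a).
Proof.
move=> [Bc c0] Aa; split=> [|g Ag]; first exact: BJ.
by rewrite -conjgM; apply/c0/AM.
Qed.

Let C_comm : forall a b, A a -> A b -> C [~ a, b].
Proof.
have Al s : A (\prod_(i <- s) y i).
  by elim: s => [|i s IH]; rewrite ?big_nil // big_cons; apply: AM.
have Cyb i s : C [~ y i, \prod_(j <- s) y j].
  elim: s => [|j s IH]; first by rewrite big_nil commg1.
  rewrite big_cons; set b := \prod_(_ <- _) _ in IH *.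
  have -> : [~ y i, y j * b] = [~ y i, b] * [~ y i, y j] ^ b.
    by rewrite /commg /conjg !invgM !mulgA mulgK mulgK.
  apply: CM => //; apply: CJ; last exact: Al.
  by split=> [|g Ag]; [exact: comm_AB | exact: phi_comm].
move=> _ _ /gen_y [s ->] /gen_y [t ->]; set b := \prod_(_ <- t) _.
elim: s => [|i s IH]; first by rewrite big_nil comm1g.
rewrite big_cons; set a := \prod_(_ <- _) _ in IH *.
have -> : [~ y i * a, b] = [~ y i, b] ^ a * [~ a, b].
  by rewrite /commg /conjg !invgM !mulgA mulgK mulgK.
by apply: CM => //; apply: CJ; [exact: Cyb | exact: Al].
Qed.

Let AX a n : A a -> A (a ^+ n).
Proof. by move=> Aa; elim: n => [|n IH]; rewrite ?expg0 // expgS; apply: AM. Qed.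

Let C_expMn a b n : A a -> A b -> exists2 c, C c & (a * b) ^+ n = a ^+ n * b ^+ n * c.
Proof.
move=> Aa Ab; elim: n => [|n [c Cc E]]; first by exists 1; rewrite ?expg0 ?mulg1.
(* moving b^n past a costs the first factor, moving c past a b the second *)
exists ([~ b ^+ n, a] ^ b * c ^ (a * b)).
  by apply: CM; apply: CJ => //; [apply: C_comm => //; apply: AX | exact: AM].
by rewrite !expgSr E /commg /conjg !invgM !mulgA !mulgK.
Qed.

Lemma hom_vanish b : B b -> phi b = 0%R.
Proof.
have phi_powA a : A a -> phi (a ^+ M) = 0%R.
  move=> /gen_y [s ->]; elim: s => [|i s IH]; first by rewrite big_nil expg1n.
  have As : A (\prod_(i <- s) y i).
    by elim: s {IH} => [|j s IH]; rewrite ?big_nil // big_cons; apply: AM.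
  rewrite big_cons; have [c [Bc c0] ->] := C_expMn M (Ay i) As.
  have c00 : phi c = 0%R by rewrite -(c0 1) // conjg1.
  have [Bi Bs] : B (y i ^+ M) /\ B ((\prod_(i <- s) y i) ^+ M).
    by split; apply: pow_AB.
  by rewrite !phiM ?IH ?phi_pow ?c00 ?addr0 //; apply: BM.
move=> Bb; have BX n : B (b ^+ n) /\ phi (b ^+ n) = (phi b *+ n)%R.
  elim: n => [|n [Bn IH]]; first by rewrite expg0.
  by rewrite expgS mulrS phiM // IH; split=> //; exact: BM.
have /eqP := phi_powA b (BA Bb); rewrite (BX M).2 mulrn_eq0 eqn0Ngt M_gt0.
by move/eqP.
Qed.

End HomVanish.

Section Schreier.
Context (Q : mgroup).

(** The section can be prescribed at one point; this normalises the
    representative of 1, or makes a given word the representative of its value. *)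
Lemma exists_section (u : word) :
  exists t : Q -> word, (forall v, ev Q (t v) = v) /\ t (ev Q u) = u.
Proof.
have /choice [t tP] := @gen_surj Q.
exists (fun v => if v == ev Q u then u else t v); rewrite eqxx; split=> // v.
by case: eqP => [->|].
Qed.

Context (t : Q -> word) (tP : forall v, ev Q (t v) = v).

(** The Schreier generators of the kernel of F -> Q: follow the representative
    of a vertex, then an edge, and come back along the representative of its
    end. *)
Definition schreier (e : Q * letter) : word :=
  t e.1 ++ e.2 :: rev (t (e.1 * gen e.2)%g).

Lemma ev_schreier e : ev Q (schreier e) = 1%g.
Proof.
rewrite /schreier evalw_cat evalw_cons (evalw_rev (@gen_inv Q)) !tP.
by rewrite mulgA mulgV.
Qed.

Context (G : groupType) (gam : letter -> G) (gam_inv : forall s, (gam s * gam s = 1)%g).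

Lemma evalw_schreier v w : exists s : seq (Q * letter),
  (evalw gam (t v) * evalw gam w =
   (\prod_(e <- s) evalw gam (schreier e)) * evalw gam (t (v * ev Q w)))%g.
Proof.
elim: w v => [|s w IH] v; first by exists [::]; rewrite !evalw_nil !mulg1 big_nil mul1g.
have [l lP] := IH (v * gen s)%g; exists ((v, s) :: l).
rewrite big_cons !evalw_cons [(v * (gen s * _))%g]mulgA -[(_ * _ * evalw _ (t _))%g]mulgA -lP.
by rewrite /schreier /= evalw_cat evalw_cons (evalw_rev gam_inv) !mulgA mulgVK.
Qed.

(** Conversely to [psum], a homomorphism on the kernel comes from an edge
    function, namely its values at the Schreier generators. *)
Lemma schreier_psum (phi : G -> rat) v w :
  (forall a b, ev Q a = 1%g -> ev Q b = 1%g ->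
     phi (evalw gam a * evalw gam b)%g = phi (evalw gam a) + phi (evalw gam b)) ->
  psum (fun v s => phi (evalw gam (schreier (v, s)))) v w =
  phi (evalw gam (t v ++ w ++ rev (t (v * ev Q w)%g))).
Proof.
move=> phiM; have E := evalw_rev (@gen_inv Q).
have phi1 : phi 1%g = 0.
  have E1 := phiM [::] [::] (evalw_nil _) (evalw_nil _).
  rewrite !evalw_nil mulg1 in E1.
  by apply: (addrI (phi 1%g)); rewrite addr0 -E1.
elim: w v => [|s w IH] v /=.
  by rewrite evalw_nil mulg1 evalw_cat (evalw_rev gam_inv) mulgV phi1.
rewrite IH -phiM ?ev_schreier //; last first.
  by rewrite !evalw_cat E !tP mulgA mulgV.
congr phi; rewrite evalw_cons mulgA /schreier /=.
rewrite !(evalw_cat, evalw_cons, evalw_rev gam_inv) !mulgA mulgVK //.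
Qed.

End Schreier.

(** * One step of the construction *)

(** [phi] restricts to a homomorphism on the image in G of the kernel of
    F -> Q. *)
Definition additive_on (Q : mgroup) (G : groupType) (gam : letter -> G) (phi : G -> rat) :=
  forall a b, ev Q a = 1%g -> ev Q b = 1%g ->
    phi (evalw gam a * evalw gam b)%g = phi (evalw gam a) + phi (evalw gam b).

Section OddStage.
Context (Q Q' : mgroup) (R : seq (word * nat)) (M : nat) (t : Q -> word).
Hypotheses (tP : forall v, ev Q (t v) = v) (t1 : t 1%g = [::]) (M_gt0 : (0 < M)%N).
Hypothesis (kerQ : forall w, ev Q' w = 1%g -> ev Q w = 1%g).
Hypothesis (powQ : forall w, ev Q w = 1%g -> ev Q' (wpow w M) = 1%g).
Hypothesis (commQ : forall a b, ev Q a = 1%g -> ev Q b = 1%g -> ev Q' (wcomm a b) = 1%g).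
Hypothesis (R1 : forall r, r \in R -> ev Q' (wpow r.1 r.2) = 1%g).
Context (G : groupType) (gam : letter -> G).
Hypothesis (gam_inv : forall s, (gam s * gam s = 1)%g).
Hypothesis (relG : forall r, r \in R -> evalw gam (wpow r.1 r.2) = 1%g).

(** Either a power of x is trivial in G and the values of [phi] have no torsion,
    or [phi] gives an edge function that kills R, hence kills x by assumption.
    Taking u^-1 as the representative of its value turns the conjugate of x by u
    into x read from another vertex. *)
Lemma hom_conj_eq0 (phi : G -> rat) x u : additive_on Q' gam phi -> ev Q' x = 1%g ->
  (forall om : Q' -> letter -> int, kills om R -> psum om 1%g x = 0) \/
  (exists2 m, (0 < m)%N & evalw gam (wpow x m) = 1%g) ->
  phi (evalw gam x ^ evalw gam u)%g = 0.
Proof.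
move=> phiM x1 xP; have E := evalw_rev (@gen_inv Q').
have phi1 : phi 1%g = 0.
  have E1 := phiM [::] [::] (evalw_nil _) (evalw_nil _).
  rewrite !evalw_nil mulg1 in E1.
  by apply: (addrI (phi 1%g)); rewrite addr0 -E1.
set z := rev u ++ x ++ u.
have zE : (evalw gam x ^ evalw gam u)%g = evalw gam z.
  by rewrite /z !evalw_cat (evalw_rev gam_inv).
have z1 : ev Q' z = 1%g by rewrite /z !evalw_cat E x1 mul1g mulVg.
case: xP => [xP|[m m_gt0 xm]]; last first.
  have phiX n : phi (evalw gam (wpow z n)) = phi (evalw gam z) *+ n.
    elim: n => [|n IH]; first by rewrite /wpow /= evalw_nil phi1.
    rewrite mulrS -IH -phiM //; last by rewrite evalw_wpow z1 expg1n.
    by rewrite !evalw_wpow expgS.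
  have := phiX m; rewrite evalw_wpow -zE -conjXg -evalw_wpow xm conj1g phi1.
  by move/esym/eqP; rewrite mulrn_eq0 eqn0Ngt m_gt0 => /eqP.
have [t' [t'P t'u]] := exists_section Q' (rev u).
pose om v s := phi (evalw gam (schreier t' (v, s))).
have omE := schreier_psum t'P gam_inv _ _ phiM.
have omR : kills om R.
  move=> r rR v; rewrite omE R1 // mulg1 !evalw_cat relG // mul1g.
  by rewrite (evalw_rev gam_inv) mulgV phi1.
rewrite zE; apply: contrapT => /eqP phi0.
have : psum om (ev Q' (rev u)) x != 0.
  by rewrite omE x1 mulg1 t'u revK.
rewrite -[ev Q' (rev u)]mulg1 -psum_translate.
move=> /(psum_int (kills_translate _ omR)) [om' om'R].
by rewrite xP ?eqxx.
Qed.

Hypothesis (comm_rel : forall e e', let x := wcomm (schreier t e) (schreier t e') in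
  (forall om : Q' -> letter -> int, kills om R -> psum om 1%g x = 0) \/
  (exists2 m, (0 < m)%N & evalw gam (wpow x m) = 1%g)).

Lemma odd_stage_vanish (phi : G -> rat) : additive_on Q' gam phi ->
  (forall e, phi (evalw gam (wpow (schreier t e) M)) = 0) ->
  forall w, ev Q' w = 1%g -> phi (evalw gam w) = 0.
Proof.
move=> phiM phi_pow w w1; have E (P : mgroup) := evalw_rev (@gen_inv P).
have evJ (P : mgroup) a g : ev P a = 1%g -> ev P (rev g ++ a ++ g) = 1%g.
  by move=> a1; rewrite !evalw_cat E a1 mul1g mulVg.
pose A g := exists2 w, ev Q w = 1%g & evalw gam w = g.
pose B g := exists2 w, ev Q' w = 1%g & evalw gam w = g.
apply: (@hom_vanish G A B _ (fun e => evalw gam (schreier t e)) M phi) => //.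
- by exists [::]; rewrite ?evalw_nil.
- by move=> _ _ [a a1 <-] [b b1 <-]; exists (a ++ b); rewrite evalw_cat // a1 b1 mulg1.
- by exists [::]; rewrite ?evalw_nil.
- by move=> _ _ [a a1 <-] [b b1 <-]; exists (a ++ b); rewrite evalw_cat // a1 b1 mulg1.
- move=> _ _ [a a1 <-] [b b1 <-]; exists (rev b ++ a ++ b); first exact: evJ.
  by rewrite !evalw_cat (evalw_rev gam_inv).
- by move=> _ [a a1 <-]; exists a; rewrite ?kerQ.
- by move=> e; exists (schreier t e); rewrite ?ev_schreier.
- move=> _ [a a1 <-]; have [s] := evalw_schreier t gam_inv 1%g a.
  by rewrite mul1g a1 t1 evalw_nil mul1g mulg1 => ->; exists s.
- move=> _ _ [a a1 <-] [b b1 <-]; exists (wcomm a b); first exact: commQ.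
  exact: evalw_wcomm.
- by move=> _ [a a1 <-]; exists (wpow a M); [exact: powQ | exact: evalw_wpow].
- by move=> _ _ [a a1 <-] [b b1 <-]; exact: phiM.
- move=> e e' _ [u _ <-]; rewrite -(evalw_wcomm gam_inv).
  by apply: hom_conj_eq0 => //; apply: commQ; exact: ev_schreier.
- by move=> e; rewrite -evalw_wpow.
- by exists w.
Qed.

End OddStage.

(** The squares of the three letters contribute 3 / 2 to the sum.  The bound
    7 / 4 leaves room for further relators, and still gives a quarter of |Q|
    independent homomorphisms since 3 - 7 / 4 - 1 = 1 / 4. *)
Definition admissible (Q : mgroup) (R : seq (word * nat)) :=
  [/\ has_involutions R, forall r, r \in R -> #[ev Q r.1]%g = r.2
    & \sum_(r <- R) (r.2%:R)^-1 < 7 / 4 :> rat].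

Lemma admissible_dim Q R : admissible Q R ->
  (\sum_(r <- R) #|Q| %/ r.2)%N%:R <= 7 / 4 * #|Q|%:R :> rat.
Proof.
case=> _ _ /ltW sR; apply: le_trans (ler_wpM2r (ler0n _ _) sR).
rewrite natr_sum mulr_suml; apply: ler_sum => r _.
case: (posnP r.2) => [->|r2]; first by rewrite divn0 mulr_ge0 ?invr_ge0.
by rewrite mulrC ler_pdivlMr ?ltr0n // -natrM ler_nat leq_divM.
Qed.

Lemma admissible_relators Q R : admissible Q R ->
  forall r, r \in R -> ev Q (wpow r.1 r.2) = 1%g.
Proof. by case=> _ ordR _ r rR; rewrite evalw_wpow -ordR // expg_order. Qed.

Lemma order_extension (Q Q' : mgroup) x m : #[ev Q x]%g = m ->
  (forall w, ev Q' w = 1%g -> ev Q w = 1%g) -> ev Q' (wpow x m) = 1%g -> #[ev Q' x]%g = m.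
Proof.
move=> ordx kerQ xm; apply/eqP; rewrite eqn_dvd order_dvdn -evalw_wpow xm eqxx.
rewrite -ordx order_dvdn -evalw_wpow; apply/eqP/kerQ.
by rewrite evalw_wpow expg_order.
Qed.

(** The kernel of [Q'] is the odd term between the kernels of [Q] and [Q''].
    The loops [z] stand for the M-th powers of the Schreier generators of the kernel of
    F -> Q; that they detect all homomorphisms bounds the Betti number of the odd
    term by their number 3 |Q|. *)
Definition next_stage (n : nat) (Q : mgroup) (R : seq (word * nat)) (Q' Q'' : mgroup)
    (R'' : seq (word * nat)) : Prop :=
  [/\ admissible Q'' R'' /\ {subset R <= R''},
      (forall w, ev Q'' w = 1%g -> ev Q' w = 1%g) /\ (forall w, ev Q' w = 1%g -> ev Q w = 1%g),
      forall r, r \in R'' -> r \in R \/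
        exists a b, [/\ ev Q a = 1%g, ev Q b = 1%g & r.1 = wcomm a b],
      exists2 M, (n <= M)%N & forall w, ev Q' w = 1%g ->
        forall om : Q -> letter -> int, kills om R -> forall v, (M %| psum om v w)%Z
    & (24 * #|Q| <= #|Q'|)%N /\ exists z : Q * letter -> word, (forall e, ev Q' (z e) = 1%g) /\
       forall (G : groupType) (gam : letter -> G),
         (forall s, gam s * gam s = 1)%g ->
         (forall r, r \in R'' -> evalw gam (wpow r.1 r.2) = 1%g) ->
         forall phi, additive_on Q' gam phi -> (forall e, phi (evalw gam (z e)) = 0) ->
         forall w, ev Q' w = 1%g -> phi (evalw gam w) = 0].

(** The independent homomorphisms exist in positive number, and clearing
    denominators gives one with integer values. *)
Lemma exists_loop Q R : admissible Q R -> exists (om : Q -> letter -> int) w,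
  [/\ kills om R, ev Q w = 1%g & psum om 1%g w != 0].
Proof.
move=> adm; have [invR ordR _] := adm.
have [[|k] [om [dk omR free]]] := independent_edge_functions invR ordR.
  have := admissible_dim adm; move: dk; rewrite add0n -(ler_nat rat) natrM => dk sk.
  have : 0 < #|Q|%:R :> rat by rewrite ltr0n; apply/card_gt0P; exists 1%g.
  lra.
apply: contrapT => no.
have : 1 = 0 :> rat.
  apply: (free (fun i => (i == ord0)%:R) _ ord0) => w w1.
  rewrite (bigD1 ord0) // eqxx mul1r big1 /= ?addr0; last first.
    by move=> i /negbTE ->; rewrite mul0r.
  apply: contrapT => /eqP p0; have [om' om'R p'0] := psum_int (omR ord0) p0.
  by apply: no; exists om', w.
by apply/eqP/oner_neq0.
Qed.

(** The two moduli are chosen in turn: M so that a loop with nonzero sum gets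
    order at least 24 |Q|, which makes [Q'] large; then M' so that every
    commutator with a nonzero sum gets order at least L, where L is so large that
    all the new relators fit into the room left by [admissible]. *)
Lemma exists_next_stage n Q R : admissible Q R ->
  exists Q' Q'' R'', next_stage n Q R Q' Q'' R''.
Proof.
move=> adm; have [invR ordR sumR] := adm; have R1 := admissible_relators adm.
have [om0 [w0 [om0R w01 pw0]]] := exists_loop adm.
(* at least n, at least 2, and 24 |Q| times the sum that w0 has to annihilate *)
pose M := (24 * #|Q| * `|psum om0 1%g w0| + n + 2)%N.
have M1 : (1 < M)%N by rewrite /M addn2.
have [Q' [kerQ R1' divQ [powQ commQ]]] := extension_spec invR M1 R1.
have cardQ' : (24 * #|Q| <= #|Q'|)%N.
  have := extension_order divQ om0R w01 pw0.
  have : (#[ev Q' w0]%g <= #|Q'|)%N by rewrite subset_leq_card //; apply/fintype.subsetP.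
  have : (0 < `|psum om0 1%g w0|)%N by rewrite absz_gt0.
  by rewrite /M => p0 oQ le; rewrite -(leq_pmul2r p0); nia.
have [t [tP t1]] := exists_section Q [::]; rewrite evalw_nil in t1.
pose xs := [seq wcomm (schreier t e.1) (schreier t e.2) | e : (Q * letter) * (Q * letter)].
(* the commutators that need a relator *)
pose alive x := `[< exists om : Q' -> letter -> int, kills om R /\ psum om 1%g x != 0 >].
have xs1 x : x \in xs -> ev Q' x = 1%g.
  by case/codomP => e ->; apply: commQ; exact: ev_schreier.
have [p pP] : exists p : word -> nat, forall x, alive x -> (0 < p x)%N /\
    exists om : Q' -> letter -> int, kills om R /\ `|psum om 1%g x|%N = p x.
  have /choice [p pP] : forall x, exists k, alive x -> (0 < k)%N /\
    exists om : Q' -> letter -> int, kills om R /\ `|psum om 1%g x|%N = k.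
    move=> x; case: (boolP (alive x)) => [/asboolP [om [omR p0]]|_]; last by exists 0%N.
    by exists `|psum om 1%g x|%N => _; rewrite absz_gt0; split=> //; exists om.
  by exists p.
have [L L_gt0 LP] : exists2 L, (0 < L)%N &
    \sum_(r <- R) (r.2%:R)^-1 + (size xs)%:R / L%:R < 7 / 4 :> rat.
  pose d : rat := 7 / 4 - \sum_(r <- R) (r.2%:R)^-1.
  have d0 : 0 < d by rewrite /d subr_gt0.
  (* L > size xs / d, where d is the room left *)
  exists (Num.truncn ((size xs)%:R / d)).+1 => //.
  rewrite -ltrBrDl ltr_pdivrMr ?ltr0n // mulrC -ltr_pdivrMr //.
  by case/andP: (truncn_itv (divr_ge0 (ler0n _ (size xs)) (ltW d0))).
pose ys := [seq x <- xs | alive x].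
pose M' := (L * (\sum_(x <- ys) p x) + 2)%N.
have M'1 : (1 < M')%N by rewrite /M' addn2.
have [Q'' [kerQ' R1'' divQ' _]] := extension_spec invR M'1 R1'.
have ordx x : x \in ys -> (L <= #[ev Q'' x]%g)%N.
  move=> xys; have := xys; rewrite mem_filter => /andP [ax xxs].
  have [px [om [omR omx]]] := pP x ax.
  have := extension_order (v := 1%g) (x := x) divQ' omR (xs1 _ xxs).
  rewrite -absz_gt0 omx => /(_ px) le.
  have : (p x <= \sum_(x <- ys) p x)%N by rewrite (big_rem x) //= leq_addr.
  by rewrite -(leq_pmul2r px) => ps; move: le; rewrite /M'; nia.
pose R'' := R ++ [seq (x, #[ev Q'' x]%g) | x <- ys].
exists Q', Q'', R''; split=> //.
- split=> [|r rR]; last by rewrite mem_cat rR.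
  split.
  + by move=> s; rewrite mem_cat invR.
  + move=> r; rewrite mem_cat => /orP [rR|/mapP [x _ ->]] //.
    by apply: (order_extension (ordR r rR)) => [w /kerQ' /kerQ|] //; exact: R1''.
  + rewrite big_cat big_map /=; apply: le_lt_trans LP; rewrite lerD2l.
    have sys : (size ys)%:R / L%:R <= (size xs)%:R / L%:R :> rat.
      by rewrite ler_pM2r ?invr_gt0 ?ltr0n // ler_nat size_filter count_size.
    apply: le_trans sys; rewrite big_seq.
    apply: (@le_trans _ _ (\sum_(x <- ys | x \in ys) L%:R^-1)).
      apply: ler_sum => x xys; rewrite lef_pV2 ?posrE ?ltr0n ?fingroup.order_gt0 //.
      by rewrite ler_nat ordx.
    by rewrite -big_seq big_const_seq count_predT iter_addr_0 mulr_natl.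
- move=> r; rewrite mem_cat => /orP [rR|/mapP [x]]; first by left.
  rewrite mem_filter => /andP [_ /codomP [e ->] ->]; right.
  by exists (schreier t e.1), (schreier t e.2); rewrite !ev_schreier.
- by exists M => //; rewrite /M; lia.
- split=> //; exists (fun e => wpow (schreier t e) M); split=> [e|].
    by apply: powQ; exact: ev_schreier.
  move=> G gam gam_inv relG phi phiM phi0.
  have relG' r : r \in R -> evalw gam (wpow r.1 r.2) = 1%g.
    by move=> rR; apply: relG; rewrite mem_cat rR.
  apply: (odd_stage_vanish tP t1 (ltnW M1) kerQ powQ commQ R1' gam_inv relG') phi0 => //.
  move=> e e' x; case: (boolP (alive x)) => [ax|/asboolPn nx].
    right; exists #[ev Q'' x]%g; first exact: fingroup.order_gt0.
    apply: (relG (x, #[ev Q'' x]%g)); rewrite mem_cat; apply/orP; right.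
    apply/mapP; exists x => //; rewrite mem_filter ax; apply/codomP.
    by exists (e, e').
  left=> om omR; apply: contrapT => /eqP p0.
  by apply: nx; exists om.
Qed.

(** * The limit group and the kernels of its finite quotients *)

(** The group of words modulo equality of values in all the P i: the subgroup
    generated by the letters in the product of the P i. *)
Section LimitGroup.
Local Open Scope quotient_scope.
Context (P : nat -> mgroup).

Definition same_values : rel word := fun u w => `[< forall i, ev (P i) u = ev (P i) w >].

Lemma same_values_refl : reflexive same_values.
Proof. by move=> w; apply/asboolP. Qed.

Lemma same_values_sym : symmetric same_values.
Proof. by move=> u w; apply/asboolP/asboolP => uw i. Qed.

Lemma same_values_trans : transitive same_values.
Proof.
by move=> w u z /asboolP uw /asboolP wz; apply/asboolP => i; rewrite uw.
Qed.

Canonical same_values_equiv :=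
  EquivRel same_values same_values_refl same_values_sym same_values_trans.

Definition limit_type := {eq_quot same_values}.
HB.instance Definition _ := Choice.on limit_type.

Definition limit_class (w : word) : limit_type := \pi_(limit_type) w.
Definition limit_ev i (x : limit_type) : P i := ev (P i) (repr x).

Lemma limit_evE i w : limit_ev i (limit_class w) = ev (P i) w.
Proof.
rewrite /limit_ev; have /eqmodP /asboolP : repr (limit_class w) = w %[mod limit_type].
  by rewrite reprK.
exact.
Qed.

Lemma limit_ext x y : (forall i, limit_ev i x = limit_ev i y) -> x = y.
Proof.
by move=> xy; rewrite -[x]reprK -[y]reprK; apply/eqmodP/asboolP.
Qed.

Definition limit_mul (x y : limit_type) := limit_class (repr x ++ repr y).
Definition limit_inv (x : limit_type) := limit_class (rev (repr x)).

Lemma limit_evM i x y : limit_ev i (limit_mul x y) = (limit_ev i x * limit_ev i y)%g.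
Proof. by rewrite limit_evE evalw_cat. Qed.

Lemma limit_evV i x : limit_ev i (limit_inv x) = (limit_ev i x)^-1%g.
Proof. by rewrite limit_evE (evalw_rev (@gen_inv _)). Qed.

Lemma limit_ev1 i : limit_ev i (limit_class [::]) = 1%g.
Proof. by rewrite limit_evE evalw_nil. Qed.

Lemma limit_mulA : associative limit_mul.
Proof. by move=> x y z; apply: limit_ext => i; rewrite !limit_evM mulgA. Qed.

Lemma limit_mul1g : left_id (limit_class [::]) limit_mul.
Proof. by move=> x; apply: limit_ext => i; rewrite limit_evM limit_ev1 mul1g. Qed.

Lemma limit_mulg1 : right_id (limit_class [::]) limit_mul.
Proof. by move=> x; apply: limit_ext => i; rewrite limit_evM limit_ev1 mulg1. Qed.

Lemma limit_mulVg : left_inverse (limit_class [::]) limit_inv limit_mul.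
Proof. by move=> x; apply: limit_ext => i; rewrite limit_evM limit_evV limit_ev1 mulVg. Qed.

Lemma limit_mulgV : right_inverse (limit_class [::]) limit_inv limit_mul.
Proof. by move=> x; apply: limit_ext => i; rewrite limit_evM limit_evV limit_ev1 mulgV. Qed.

HB.instance Definition _ := isGroup.Build limit_type
  limit_mulA limit_mul1g limit_mulg1 limit_mulVg limit_mulgV.

Lemma limit_group : exists (G : groupType) (gam : letter -> G) (f : forall i, G -> P i),
  [/\ forall i x y, f i (x * y)%g = (f i x * f i y)%g,
      forall i w, f i (evalw gam w) = ev (P i) w,
      forall g, exists w, evalw gam w = g
    & forall g, (forall i, f i g = 1%g) -> g = 1%g].
Proof.
pose gam s : limit_type := limit_class [:: s].
have gamE w : evalw gam w = limit_class w.
  elim: w => [|s w IH]; first by rewrite evalw_nil.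
  rewrite evalw_cons IH; apply: limit_ext => i.
  by rewrite limit_evM !limit_evE -evalw_cat.
exists limit_type, gam, limit_ev; split=> [i x y|i w|g|g g1].
- exact: limit_evM.
- by rewrite gamE limit_evE.
- by exists (repr g); rewrite gamE /limit_class reprK.
- by apply: limit_ext => i; rewrite g1 limit_ev1.
Qed.

End LimitGroup.

Section Kernel.
Context (G H : groupType) (f : G -> H).
Hypothesis fM : forall x y, f (x * y)%g = (f x * f y)%g.

Lemma kernel_closed : exists N : groupClosed G, forall g, (g \in N) = (f g == 1%g).
Proof.
have f1 : f 1%g = 1%g by apply: (mulgI (f 1%g)); rewrite -fM !mulg1.
pose K : {pred G} := fun g => f g == 1%g.
have KM : {in K &, forall x y, (x * y)%g \in K}.
  by move=> x y /eqP x1 /eqP y1; rewrite /K unfold_in fM x1 y1 mulg1.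
have K1 : 1%g \in K by rewrite /K unfold_in f1.
have KV : {in K, forall x, x^-1%g \in K}.
  move=> x /eqP x1; rewrite /K unfold_in; apply/eqP.
  by apply: (mulgI (f x)); rewrite -fM mulgV f1 x1 mulg1.
pose N : groupClosed G := HB.pack K (isMulClosed.Build G K KM)
  (isMul1Closed.Build G K K1) (isInvClosed.Build G K KV).
by exists N.
Qed.

End Kernel.

Section KernelIndex.
Context (G : groupType) (Q : finGroupType) (f : G -> Q) (N : groupClosed G).
Hypotheses (fM : forall x y, f (x * y)%g = (f x * f y)%g).
Hypotheses (f_surj : forall q, exists g, f g = q) (NE : forall g, (g \in N) = (f g == 1%g)).

Let f1 : f 1%g = 1%g.
Proof. by apply: (mulgI (f 1%g)); rewrite -fM !mulg1. Qed.

Let fV x : f x^-1%g = (f x)^-1%g.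
Proof. by apply: (mulgI (f x)); rewrite -fM !mulgV. Qed.

Lemma kernel_normal : normal_subgroup N.
Proof.
by move=> g x; rewrite !NE /conjg !fM fV => /eqP ->; rewrite mul1g mulVg.
Qed.

Let cosetsE : left_cosets N = range (fun q => [set g | f g = q]).
Proof.
have E g : [set (g * x)%g | x in [set` N]] = [set h | f h = f g].
  apply/seteqP; split=> [_ [x /= xN <-]|h /= hg].
    by rewrite fM; move: xN; rewrite NE => /eqP ->; rewrite mulg1.
  exists (g^-1 * h)%g; last by rewrite mulVKg.
  by rewrite /= NE fM fV hg mulVg.
apply/seteqP; split=> [_ [g _ <-]|_ [q _ <-]].
  by exists (f g); rewrite // E.
by have [g <-] := f_surj q; exists g; rewrite // E.
Qed.

Let card_cosets : (left_cosets N #= `I_#|Q|)%card.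
Proof.
rewrite cosetsE; apply: (card_eq_trans (B := [set: Q])).
  apply: inj_card_eq => p q _ _ pq; have [g gp] := f_surj p.
  by have : [set g | f g = p] g by []; rewrite pq /= gp.
have -> : [set: Q] = [set` [fset x in enum Q]%fset].
  by apply/seteqP; split=> x // _; rewrite /= inE mem_enum.
by apply/card_eq_fsetP; rewrite card_fseq undup_id ?enum_uniq // cardE.
Qed.

Lemma kernel_finite_index : finite_index N.
Proof. by apply/finite_setP; exists #|Q|. Qed.

Lemma kernel_index : subgroup_index N = #|Q|.
Proof. exact: card_fset_set. Qed.

End KernelIndex.

(** * The tower and its Betti numbers *)

Fact quarter_bound (a b d s : rat) :
  2 * a <= d + s -> d <= b -> s <= 7 / 4 * a -> a <= 4 * b.
Proof. lra. Qed.

(** All letters map to the generator of a group of order two. *)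
Lemma exists_first_stage : exists Q R, admissible Q R.
Proof.
pose p (s : letter) : {perm bool} := tperm true false.
have p_inv s : (p s * p s = 1)%g by exact: tperm2.
have [Q QP] := mark_group p_inv.
exists Q, [seq ([:: s], 2%N) | s : letter]; split.
- by move=> s; apply/codomP; exists s.
- move=> _ /codomP [s ->] /=; apply/(prime_nt_dvdP (isT : prime 2)).
    rewrite order_eq1; apply/eqP => /QP; rewrite evalw1.
    by move=> /(congr1 (fun q : {perm bool} => q true)); rewrite tpermL perm1.
  by rewrite order_dvdn -evalw_wpow; apply/eqP/QP; rewrite evalw_wpow evalw1 expg2 p_inv.
- rewrite big_image /= sumr_const card_ord.
  by lra.
Qed.

Definition tower (Q : nat -> mgroup) (R : nat -> seq (word * nat)) (Q' : nat -> mgroup) :=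
  forall n, admissible (Q n) (R n) /\ next_stage n (Q n) (R n) (Q' n) (Q n.+1) (R n.+1).

Lemma exists_tower : exists Q R Q', tower Q R Q'.
Proof.
pose stage := {x : mgroup * seq (word * nat) | admissible x.1 x.2}.
have [Q0 [R0 adm0]] := exists_first_stage.
have /choice [f fP] : forall nx : nat * stage, exists y : mgroup * stage,
    next_stage nx.1 (sval nx.2).1 (sval nx.2).2 y.1 (sval y.2).1 (sval y.2).2.
  move=> [n [[Q R] adm]]; have [Q' [Q'' [R'' nP]]] := exists_next_stage n adm.
  have [[adm'' _] _ _ _ _] := nP.
  by exists (Q', exist _ (Q'', R'') adm'').
pose st := fix st n : stage :=
  if n is m.+1 then (f (m, st m)).2 else exist _ (Q0, R0) adm0.
exists (fun n => (sval (st n)).1), (fun n => (sval (st n)).2).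
exists (fun n => (f (n, st n)).1) => n.
by split; [exact: (svalP (st n)) | exact: (fP (n, st n))].
Qed.

Section Tower.
Context (Q : nat -> mgroup) (R : nat -> seq (word * nat)) (Q' : nat -> mgroup).
Hypothesis QT : tower Q R Q'.

Lemma tower_ker k n : (k <= n)%N -> forall w, ev (Q n) w = 1%g -> ev (Q k) w = 1%g.
Proof.
move=> /subnK <-; elim: (n - k)%N => // m IH w; rewrite addSn => w1.
by have [_ [_ [k1 k2] _ _ _]] := QT (m + k); apply/IH/k2/k1.
Qed.

Lemma tower_relators k n : (k <= n)%N -> {subset R k <= R n}.
Proof.
move=> /subnK <-; elim: (n - k)%N => // m IH r /IH rR; rewrite addSn.
by have [_ [[_ sub] _ _ _ _]] := QT (m + k); apply: sub.
Qed.

(** Relators added after stage k are powers of commutators of loops of Q k, since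
    later kernels are smaller. *)
Lemma tower_new_relators k n : (k <= n)%N -> forall r, r \in R n -> r \in R k \/
  exists a b, [/\ ev (Q k) a = 1%g, ev (Q k) b = 1%g & r.1 = wcomm a b].
Proof.
move=> /subnK <-; elim: (n - k)%N => [|m IH] r; first by left.
rewrite addSn; have [_ [_ _ + _ _]] := QT (m + k) => /[apply] -[/IH //|[a [b [a1 b1 E]]]].
by right; exists a, b; split=> //; apply: (tower_ker (leq_addl m k)).
Qed.

(** Pull [om] back to stage n.  It kills the relators of stage k by assumption
    and the later ones because they are powers of commutators of loops.  So its
    sum along [w] is divisible by a modulus at least n, and n may be taken larger
    than this sum. *)
Lemma tower_survival k (om : Q k -> letter -> int) w : kills om (R k) ->
  (forall j, ev (Q j) w = 1%g) -> psum om 1%g w = 0.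
Proof.
move=> omR w1; apply: contrapT => /eqP p0.
pose n := maxn k `|psum om 1%g w|.+1.
have kn : (k <= n)%N by exact: leq_maxl.
have [[invR _ _] _] := QT k.
have [_ [_ [kerQ' _] _ [M nM divM] _]] := QT n.
have /choice [t tP] := @gen_surj (Q n).
have ker_eq a b : ev (Q n) a = ev (Q n) b -> ev (Q k) a = ev (Q k) b.
  have E j := evalw_rev (@gen_inv (Q j)).
  move=> ab; apply: divg1_eq; rewrite -E -evalw_cat; apply: (tower_ker kn).
  by rewrite evalw_cat E ab mulgV.
pose om' (v : Q n) s := om (ev (Q k) (t v)) s.
have om'E v u : psum om' v u = psum om (ev (Q k) (t v)) u.
  elim: u v => //= s u IH v; rewrite IH; congr (_ + psum _ _ _).
  rewrite -(evalw1 (@gen (Q k)) s) -evalw_cat; apply: ker_eq.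
  by rewrite evalw_cat !tP evalw1.
have om'R : kills om' (R n).
  move=> r rRn v; rewrite om'E; have [rRk|[a [b [a1 b1 ->]]]] := tower_new_relators kn rRn.
    exact: omR.
  rewrite psum_loop; first by rewrite (psum_wcomm invR omR) // mul0rn.
  by rewrite (evalw_wcomm (@gen_inv _)) a1 b1 commgg.
have := divM w (kerQ' _ (w1 n.+1)) _ om'R 1%g.
rewrite om'E (ker_eq (t 1%g) [::]) ?tP ?evalw_nil // dvdzE => /dvdn_leq.
rewrite absz_gt0 => /(_ p0); apply/negP; rewrite -ltnNge.
by apply: leq_trans nM; exact: leq_maxr.
Qed.

Definition chain i : mgroup := if odd i then Q' i./2 else Q i./2.

Lemma chain_even k : chain k.*2 = Q k.
Proof. by rewrite /chain odd_double doubleK. Qed.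

Lemma chain_odd k : chain k.*2.+1 = Q' k.
Proof. by rewrite /chain /= odd_double /= uphalf_double. Qed.

Lemma chain_ker i w : ev (chain i.+1) w = 1%g -> ev (chain i) w = 1%g.
Proof.
rewrite -(odd_double_half i); case: (odd i) => /=.
  rewrite add1n chain_odd -doubleS chain_even.
  by have [_ [_ [+ _] _ _ _]] := QT i./2; apply.
by rewrite add0n chain_odd chain_even; have [_ [_ [_ +] _ _ _]] := QT i./2; apply.
Qed.

Lemma chain_ker_le i j w : (i <= j)%N -> ev (chain j) w = 1%g -> ev (chain i) w = 1%g.
Proof. by move=> /subnK <-; elim: (j - i)%N => // m IH w1; apply/IH/chain_ker. Qed.

Section InGroup.
Context (G : groupType) (gam : letter -> G) (f : forall i, G -> chain i).
Hypothesis (fE : forall i w, f i (evalw gam w) = ev (chain i) w).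
Hypothesis (gam_surj : forall g, exists w, evalw gam w = g).
Hypothesis (f_inj : forall g, (forall i, f i g = 1%g) -> g = 1%g).
Context (N : nat -> groupClosed G).
Hypothesis (NE : forall i g, (g \in N i) = (f i g == 1%g)).

Lemma gam_eq1 w : (forall i, ev (chain i) w = 1%g) -> evalw gam w = 1%g.
Proof. by move=> w1; apply: f_inj => i; rewrite fE; exact: w1. Qed.

Lemma gam_inv s : (gam s * gam s = 1)%g.
Proof.
rewrite -[LHS](_ : evalw gam [:: s; s] = _); last by rewrite !evalw_cons evalw_nil mulg1.
by apply: gam_eq1 => i; rewrite !evalw_cons evalw_nil mulg1 gen_inv.
Qed.

(** Kernels decrease, so triviality in G can be tested far along the tower, where
    the relator is still listed. *)
Lemma gam_relators n r : r \in R n -> evalw gam (wpow r.1 r.2) = 1%g.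
Proof.
move=> rR; apply: gam_eq1 => i; apply: (@chain_ker_le _ (maxn n i).*2).
  by have := leq_maxr n i; lia.
rewrite chain_even; have [adm _] := QT (maxn n i).
by apply: (admissible_relators adm); apply: tower_relators rR; exact: leq_maxl.
Qed.

Lemma word_in_N i w : (evalw gam w \in N i) = (ev (chain i) w == 1%g).
Proof. by rewrite NE fE. Qed.

(** There are 3 |Q k| test elements [z], one for each edge of the Cayley
    graph. *)
Lemma odd_first_betti k :
  (first_betti (subgroup (N k.*2.+1)) <= 3 * #|Q k|)%N.
Proof.
have [_ [_ _ _ _ [_ [z [z1 zP]]]]] := QT k.
have inN w : ev (Q' k) w = 1%g -> evalw gam w \in N k.*2.+1.
  by move=> w1; rewrite word_in_N chain_odd w1.
pose y e : subgroup (N k.*2.+1) := Subgroup (inN _ (z1 e)).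
rewrite -(card_ord 3) mulnC -card_prod; apply: (@first_betti_le _ _ y) => phi phiM phi0 h.
pose phi' (g : G) : rat := if insub g is Some x then phi x else 0.
have phi'E (x : subgroup (N k.*2.+1)) : phi' (val x) = phi x.
  by rewrite /phi' valK.
have [w wh] := gam_surj (val h).
rewrite -phi'E -wh; apply: (zP G gam gam_inv _ phi').
- by move=> r; exact: gam_relators.
- move=> a b a1 b1.
  have := phiM (Subgroup (inN _ a1)) (Subgroup (inN _ b1)).
  by rewrite -!phi'E.
- by move=> e; rewrite -(phi0 e) -phi'E.
- have := valP h; rewrite /= -wh word_in_N chain_odd => /eqP; exact.
Qed.

(** The homomorphism of an edge function is evaluated on any word that
    represents the group element; two such words differ by an element of the
    intersection of all kernels, along which the sum vanishes. *)
Lemma even_first_betti k :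
  (#|Q k| <= 4 * first_betti (subgroup (N k.*2)))%N.
Proof.
have [adm _] := QT k; have [invR ordR _] := adm.
have [d [om [dQ omR free]]] := independent_edge_functions invR ordR.
suff le : (d <= first_betti (subgroup (N k.*2)))%N.
  have := admissible_dim adm; move: dQ le.
  rewrite -(ler_nat rat) natrD natrM -(ler_nat rat) => dQ le sQ.
  rewrite -(ler_nat rat) natrM; exact: quarter_bound dQ le sQ.
have inN w : ev (Q k) w = 1%g -> evalw gam w \in N k.*2.
  by move=> w1; rewrite word_in_N chain_even w1.
have Nin w : evalw gam w \in N k.*2 -> ev (Q k) w = 1%g.
  by rewrite word_in_N chain_even => /eqP.
have [t [tP t1]] := exists_section (Q k) [::]; rewrite evalw_nil in t1.
pose y e : subgroup (N k.*2) := Subgroup (inN _ (ev_schreier tP e)).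
have /choice [wd wdE] := gam_surj.
have psum_gam i a b : evalw gam a = evalw gam b ->
    psum (uncurried (om i)) 1%g a = psum (uncurried (om i)) 1%g b.
  move=> ab; have ev_ab j : ev (Q j) a = ev (Q j) b by rewrite -chain_even -!fE ab.
  apply: (psum_endpoint invR (omR i) (ev_ab k)); apply: contrapT => /eqP p0.
  have [om' om'R /eqP] := psum_int (omR i) p0; apply.
  apply: tower_survival om'R _ => j.
  by rewrite evalw_cat (evalw_rev (@gen_inv _)) ev_ab mulgV.
apply: (@first_betti_ge _ _ y _
  (fun i h => psum (uncurried (om i)) 1%g (wd (val h)))) => [h|i x x'|a a0].
- have [w wh] := gam_surj (val h).
  have w1 : ev (Q k) w = 1%g by apply: Nin; rewrite wh; exact: valP.
  have [s] := evalw_schreier t gam_inv 1%g w.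
  rewrite mul1g w1 t1 evalw_nil mul1g mulg1 wh => sE; exists s; apply: val_inj.
  by rewrite sE; elim: {sE} s => [|e s IH]; rewrite ?big_nil // !big_cons IH.
- have x1 : ev (Q k) (wd (val x)) = 1%g by apply: Nin; rewrite wdE; exact: valP.
  rewrite -[RHS](_ : psum (uncurried (om i)) 1%g (wd (val x) ++ wd (val x')) = _).
    by apply: psum_gam; rewrite evalw_cat !wdE.
  by rewrite psum_cat x1 mulg1.
- apply: free => w w1; rewrite -[RHS](a0 (Subgroup (inN _ w1))); apply: eq_bigr => i _.
  by congr (_ * _); apply: psum_gam; rewrite wdE.
Qed.

End InGroup.
End Tower.

(** * The oscillation *)

Lemma oscillating_not_cvg (R : realType) (u : nat -> R) :
  (forall k, 1 / 4 <= u k.*2) -> (forall k, u k.*2.+1 <= 1 / 8) ->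
  ~ exists l : R, u i @[i --> \oo] --> l.
Proof.
move=> u_even u_odd [l /cvgrPdist_lt /(_ (1 / 16))].
have e0 : 0 < 1 / 16 :> R by lra.
move=> /(_ e0) [n _ nP].
have /= := nP n.*2; have /= := nP n.*2.+1; have := u_even n; have := u_odd n.
move=> uo ue /(_ _) do1 /(_ _) do2.
have {}do1 : `|l - u n.*2.+1| < 1 / 16 by apply: do1; lia.
have {}do2 : `|l - u n.*2| < 1 / 16 by apply: do2; lia.
move: do1 do2; rewrite !ltr_norml => /andP [? ?] /andP [? ?]; lra.
Qed.

Theorem theorem1p3 (R : realType) :
  exists (G : groupType) (N : nat -> groupClosed G),
    [/\ finitely_generated G,
        residually_finite G,
        (forall i, normal_subgroup (N i) /\ finite_index (N i)),
        (forall i, {subset N i.+1 <= N i})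
      & \bigcap_i [set` N i] = [set 1%g]]
    /\ ~ exists l : R,
         (first_betti (subgroup (N i)))%:R / (subgroup_index (N i))%:R
           @[i --> \oo] --> l.
Proof.
have [Q [rels [Q' QT]]] := exists_tower.
have [G [gam [f [fM fE gam_surj f_inj]]]] := limit_group (chain Q Q').
have /choice [N NE] i := kernel_closed (fM i).
have f_surj i q : exists g, f i g = q.
  by have [w <-] := gen_surj q; exists (evalw gam w); rewrite fE.
have N_index i := kernel_index (fM i) (f_surj i) (NE i).
have N_normal i := kernel_normal (fM i) (NE i).
have N_finite i := kernel_finite_index (fM i) (f_surj i) (NE i).
have f1 i : f i 1%g = 1%g by rewrite -(evalw_nil gam) fE evalw_nil.
have card_gt0 k : (0 < #|Q k|)%N by apply/card_gt0P; exists 1%g.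
have card_gt0' k : (0 < #|Q' k|)%N by apply/card_gt0P; exists 1%g.
exists G, N; split; last first.
  apply: oscillating_not_cvg => k; rewrite N_index.
    have := even_first_betti QT fE gam_surj f_inj NE k.
    rewrite -(ler_nat R) natrM chain_even ler_pdivlMr ?ltr0n //.
    lra.
  have [_ [_ _ _ _ [+ _]]] := QT k.
  have := odd_first_betti QT fE gam_surj f_inj NE k.
  rewrite -!(ler_nat R) !natrM chain_odd ler_pdivrMr ?ltr0n //.
  lra.
split=> [|g g1|i|i g|].
- exists [seq gam s | s : letter] => K gamK g; have [w <-] := gam_surj g.
  elim: w => [|s w IH]; first by rewrite evalw_nil gpred1.
  by rewrite evalw_cons gpredM // gamK //; apply/codomP; exists s.
- apply: contrapT => no; apply/g1/f_inj => i; apply: contrapT => /eqP fi.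
  by apply: no; exists (N i); split=> //; rewrite NE.
- by split.
- have [w <-] := gam_surj g; rewrite !NE !fE => /eqP w1.
  exact/eqP/(chain_ker QT).
- apply/seteqP; split=> [g gN|_ ->].
    by apply: f_inj => i; apply/eqP; rewrite -NE; exact: gN.
  by move=> i _; rewrite /= NE f1.
Qed.
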